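(* Let $(X,\mathcal A)$ be a measurable space and $H$ be the reproducing kernel Hilbert space of a bounded and measurable kernel $k$ on $X$ such that the kernel embedding $\Phi:\mathcal M(X)\to H$ is injective. Then the following statements are equivalent: (i) The space $\mathcal M(X)$ is finite dimensional. (ii) The norms $\|\cdot\|_H$ and $\|\cdot\|_{\mathrm{TV}}$ on $\mathcal M(X)$ are equivalent. (iii) The norm $\|\cdot\|_H$ on $\mathcal M(X)$ is complete. (iv) The kernel embedding $\Phi:\mathcal M(X)\to H$ is surjective.
   Context: A kernel on $X$ is a symmetric positive definite function $k:X\times X\to\mathbb R$ (i.e. $\sum_{i,j}a_ia_jk(x_i,x_j)\ge0$ for all finite choices). $\mathcal M(X)$ is the space of finite signed measures on $(X,\mathcal A)$, with total variation norm $\|\cdot\|_{\mathrm{TV}}$. For a bounded measurable kernel $k$ with RKHS $H$, the kernel embedding is $\Phi:\mathcal M(X)\to H$, $\Phi(\mu):=\int_X k(\cdot,x)\,\mathrm d\mu(x)$ (Pettis integral, i.e. $\langle h,\Phi(\mu)\rangle_H=\int h\,\mathrm d\mu$ for all $h\in H$). One sets $\|\mu\|_H:=\|\Phi(\mu)\|_H$ for $\mu\in\mathcal M(X)$; this is a seminorm on $\mathcal M(X)$, and a norm iff $\Phi$ is injective. *)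

(* Defs.v *)
From HB Require Import structures.
From mathcomp Require Import all_boot all_order all_algebra sesquilinear.
From mathcomp Require Import all_classical all_reals all_analysis.
Import Order.TTheory GRing.Theory Num.Theory.
Import numFieldNormedType.Exports.

Set Implicit Arguments.
Unset Strict Implicit.
Unset Printing Implicit Defensive.

Local Open Scope classical_set_scope.
Local Open Scope ring_scope.

(* A charge of the library is a function on all subsets of T, with unspecified
   values outside the sigma-algebra. Normalizing these values to 0 makes
   Leibniz equality of signed measures the equality on measurable sets, so that
   the signed measures form a vector space in the usual sense. *)
Record signed_measure d (T : measurableType d) (R : realType) := SignedMeasure {
  sm_charge :> {charge set T -> \bar R};
  sm_nonmeasurable : forall A, ~ measurable A -> sm_charge A = 0%E }.

Section signed_measure_vector_space.
Context d (T : measurableType d) (R : realType).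
Implicit Types mu nu : signed_measure T R.

Lemma charge_ext (m1 m2 : {charge set T -> \bar R}) :
  m1 = m2 :> (set T -> \bar R) -> m1 = m2.
Proof.
move: m1 m2 => [m1 [[a1] [b1] [c1]]] [m2 [[a2] [b2] [c2]]] /= m12.
by move: m12 a1 b1 c1 a2 b2 c2 => <- *;
  congr Charge.Pack; congr Charge.Class; f_equal; exact: Prop_irrelevance.
Qed.

Lemma signed_measure_ext mu nu :
  (forall A, measurable A -> mu A = nu A) -> mu = nu.
Proof.
move=> munu; have : sm_charge mu = sm_charge nu.
  apply: charge_ext; apply/funext => A.
  have [/munu//|nA] := pselect (measurable A).
  by rewrite !sm_nonmeasurable.
case: mu nu {munu} => [m mP] [n nP] /= mn.
by case: _ / mn nP => nP; congr SignedMeasure; exact: Prop_irrelevance.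
Qed.

Lemma sm_fin_num mu A : mu A \is a fin_num.
Proof.
have [mA|nA] := pselect (measurable A); first exact: fin_num_measure.
by rewrite sm_nonmeasurable.
Qed.

Lemma sm0_nonmeasurable A :
  ~ measurable A -> (@czero _ T R : {charge set T -> \bar R}) A = 0%E.
Proof. by []. Qed.

Lemma smN_nonmeasurable mu A :
  ~ measurable A -> (copp mu : {charge set T -> \bar R}) A = 0%E.
Proof. by move=> nA; rewrite /= /copp sm_nonmeasurable// oppe0. Qed.

Lemma smD_nonmeasurable mu nu A :
  ~ measurable A -> (cadd mu nu : {charge set T -> \bar R}) A = 0%E.
Proof. by move=> nA; rewrite /= /cadd !sm_nonmeasurable// adde0. Qed.

Lemma smZ_nonmeasurable (a : R) mu A :
  ~ measurable A -> (cscale a mu : {charge set T -> \bar R}) A = 0%E.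
Proof. by move=> nA; rewrite /= /cscale sm_nonmeasurable// mule0. Qed.

Definition sm_zero : signed_measure T R := SignedMeasure sm0_nonmeasurable.
Definition sm_opp mu : signed_measure T R :=
  SignedMeasure (@smN_nonmeasurable mu).
Definition sm_add mu nu : signed_measure T R :=
  SignedMeasure (@smD_nonmeasurable mu nu).
Definition sm_scale (a : R) mu : signed_measure T R :=
  SignedMeasure (@smZ_nonmeasurable a mu).

HB.instance Definition _ := gen_eqMixin (signed_measure T R).
HB.instance Definition _ := gen_choiceMixin (signed_measure T R).

Lemma sm_addA : associative sm_add.
Proof.
by move=> m n p; apply: signed_measure_ext => A _; rewrite /= /cadd/= addeA.
Qed.

Lemma sm_addC : commutative sm_add.
Proof.
by move=> m n; apply: signed_measure_ext => A _; rewrite /= /cadd/= addeC.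
Qed.

Lemma sm_add0 : left_id sm_zero sm_add.
Proof.
by move=> m; apply: signed_measure_ext => A _; rewrite /= /cadd/= add0e.
Qed.

Lemma sm_addN : left_inverse sm_zero sm_opp sm_add.
Proof.
move=> m; apply: signed_measure_ext => A _; rewrite /= /cadd/= /copp.
by rewrite addeC subee// sm_fin_num.
Qed.

HB.instance Definition _ := GRing.isZmodule.Build (signed_measure T R)
  sm_addA sm_addC sm_add0 sm_addN.

Lemma sm_scaleA (a b : R) mu :
  sm_scale a (sm_scale b mu) = sm_scale (a * b) mu.
Proof.
by apply: signed_measure_ext => A _; rewrite /= /cscale/= /cscale EFinM muleA.
Qed.

Lemma sm_scale1 : left_id 1 sm_scale.
Proof.
by move=> m; apply: signed_measure_ext => A _; rewrite /= /cscale/= mul1e.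
Qed.

Lemma sm_scaleDr : right_distributive sm_scale +%R.
Proof.
move=> a m n; apply: signed_measure_ext => A _.
rewrite /= /cscale/= /cadd/= /cscale.
by rewrite muleDr// fin_num_adde_defr// sm_fin_num.
Qed.

Lemma sm_scaleDl mu : {morph sm_scale^~ mu : a b / a + b}.
Proof.
move=> a b; apply: signed_measure_ext => A _.
rewrite /= /cscale/= /cadd/= /cscale -(fineK (sm_fin_num mu A)).
by rewrite -!EFinM -EFinD mulrDl.
Qed.

HB.instance Definition _ := GRing.Zmodule_isLmodule.Build R
  (signed_measure T R) sm_scaleA sm_scale1 sm_scaleDr sm_scaleDl.

End signed_measure_vector_space.

Section total_variation.
Context d (T : measurableType d) (R : realType).
Implicit Type mu : {charge set T -> \bar R}.

Definition hahn_sets mu :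
    {PN : set T * set T | hahn_decomposition mu PN.1 PN.2} :=
  let: exist P exN := cid (Hahn_decomposition mu) in
  let: exist N PN := cid exN in
  exist (fun PN => hahn_decomposition mu PN.1 PN.2) (P, N) PN.

Definition variation mu := charge_variation (svalP (hahn_sets mu)).

Definition tv_norm mu : R := fine (variation mu [set: T]).

(* Integral against a signed measure, through its Jordan decomposition. It is
   meaningful for functions integrable with respect to [variation mu]. *)
Definition cintegral mu (f : T -> R) : R :=
  (\int[jordan_pos (svalP (hahn_sets mu))]_x f x
   - \int[jordan_neg (svalP (hahn_sets mu))]_x f x)%R.

End total_variation.

Section norms.
Context (R : realType) (V : lmodType R).

Definition finite_dimensional :=
  exists (n : nat) (b : 'I_n -> V),
    forall v, exists c : 'I_n -> R, v = \sum_(i < n) c i *: b i.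

Definition equivalent_norms (N1 N2 : V -> R) :=
  exists c C : R, [/\ 0 < c, 0 < C &
    forall v, c * N1 v <= N2 v /\ N2 v <= C * N1 v].

Definition complete_norm (N : V -> R) :=
  forall u : nat -> V,
    (forall e, 0 < e -> \forall m & n \near \oo, N (u m - u n) < e) ->
    exists l : V, N (u n - l) @[n --> \oo] --> 0.

End norms.
Arguments finite_dimensional {R} V.

Record hilbert (R : realType) := Hilbert {
  hilbert_sort :> completeNormedModType R;
  hdot : {dot hilbert_sort for idfun};
  norm_hdot : forall h : hilbert_sort, `|h| = Num.sqrt (hdot h h) }.
Arguments hdot {R H} : rename.

Definition is_kernel (R : realType) (X : Type) (k : X -> X -> R) :=
  (forall x y, k x y = k y x) /\
  (forall (n : nat) (a : 'I_n -> R) (x : 'I_n -> X),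
    0 <= \sum_(i < n) \sum_(j < n) a i * a j * k (x i) (x j)).

(* The elements of the Hilbert space are functions on X: [rkhs_fun] is the
   linear inclusion of the space into the real functions on X, and
   [rkhs_section x] is the element k(., x). *)
Record rkhs (R : realType) (X : Type) (k : X -> X -> R) := Rkhs {
  rkhs_hilbert :> hilbert R;
  rkhs_fun : rkhs_hilbert -> X -> R;
  rkhs_fun_linear : forall (a : R) (f g : rkhs_hilbert) (x : X),
    rkhs_fun (a *: f + g) x = a * rkhs_fun f x + rkhs_fun g x;
  rkhs_fun_inj : injective rkhs_fun;
  rkhs_section : X -> rkhs_hilbert;
  rkhs_sectionE : forall x y, rkhs_fun (rkhs_section x) y = k y x;
  rkhs_reproducing : forall (h : rkhs_hilbert) (x : X),
    hdot h (rkhs_section x) = rkhs_fun h x }.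

Section kernel_embedding.
Context d (T : measurableType d) (R : realType).

Definition is_pettis_integral (H : hilbert R) (mu : {charge set T -> \bar R})
    (F : T -> H) (z : H) :=
  forall h : H,
    (variation mu).-integrable [set: T] (fun x => (hdot h (F x))%:E) /\
    hdot h z = cintegral mu (fun x => hdot h (F x)).

Context (k : T -> T -> R) (H : rkhs k).

(* Pettis integrals are unique since [hdot] is definite; the default value 0 is
   never taken when k is bounded and measurable (Riesz representation). *)
Definition kernel_embedding (mu : signed_measure T R) : H :=
  xget 0 [set z : H | is_pettis_integral mu (@rkhs_section _ _ _ H) z].

Definition rkhs_norm (mu : signed_measure T R) : R := `|kernel_embedding mu|.

End kernel_embedding.

(* Main.v *)
Require Import Defs.
From HB Require Import structures.
From mathcomp Require Import all_boot all_order all_algebra.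
From mathcomp Require Import all_classical all_reals all_analysis.
From mathcomp Require Import measurable_realfun ring lra.
Import Order.TTheory GRing.Theory Num.Theory.
Import numFieldNormedType.Exports.
Local Open Scope classical_set_scope.
Local Open Scope ring_scope.

Set Implicit Arguments.
Unset Strict Implicit.
Unset Printing Implicit Defensive.

(** Write [Phi] for the kernel embedding; it is linear, bounded for the total
    variation norm, and maps the Dirac measure at [x] to [k(., x)].

    (i) implies (ii) because all norms on a finite dimensional space are
    equivalent, and (ii) implies (iii) because the total variation norm is
    complete. If (iii) holds, then the range of [Phi] is a closed subspace of
    [H] containing all [k(., x)], and only 0 is orthogonal to these by the
    reproducing property, so that [Phi] is onto.

    If (iv) holds, then by the open mapping theorem the total variation norm is
    at most [C] times the norm of [H]. Assume that [M(X)] has infinite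
    dimension. Then there are, for each [n], points [x_1, ..., x_n] separated by
    disjoint measurable sets. In the Hilbert space [H] some choice of signs gives
    [`|\sum_i e_i k(., x_i)|^2 <= \sum_i k(x_i, x_i) <= n B^2], whereas
    [\sum_i e_i \d_(x_i)] has total variation at least [n]: this is impossible
    when [n > (C B)^2]. *)

(** * Hilbert spaces *)

Section hilbert_space.
Context (R : realType) (H : hilbert R).
Implicit Types u v w h : H.

Lemma hdotC u v : hdot u v = hdot v u.
Proof. by rewrite (@hermitian_subproof _ _ _ _ hdot) expr0 mul1r. Qed.

Lemma hdotDl u v w : hdot (u + v) w = hdot u w + hdot v w.
Proof. exact: linearDl. Qed.

Lemma hdotZl (a : R) u w : hdot (a *: u) w = a * hdot u w.
Proof. exact: linearZl_LR. Qed.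

Lemma hdotDr u v w : hdot w (u + v) = hdot w u + hdot w v.
Proof. by rewrite hdotC hdotDl 2!(hdotC _ w). Qed.

Lemma hdotZr (a : R) u w : hdot w (a *: u) = a * hdot w u.
Proof. by rewrite hdotC hdotZl (hdotC w). Qed.

Lemma hdot_normE u : hdot u u = `|u| ^+ 2.
Proof.
rewrite norm_hdot sqr_sqrtr//.
have [->|u0] := eqVneq u 0; last exact/ltW/neq0_dnorm_gt0.
by rewrite -(scale0r (0 : H)) hdotZl mul0r.
Qed.

Lemma sqr_normD u v : `|u + v| ^+ 2 = `|u| ^+ 2 + 2 * hdot u v + `|v| ^+ 2.
Proof. by rewrite -!hdot_normE !hdotDl !hdotDr (hdotC v u); ring. Qed.

(** For nonzero [v], the squared norm of [|v|^2 u - <u, v> v] is nonnegative and expands to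
    [|v|^2 (|u|^2 |v|^2 - <u, v>^2)]. *)
Lemma cauchy_schwarz u v : `|hdot u v| <= `|u| * `|v|.
Proof.
have [->|v0] := eqVneq v 0.
  by rewrite -(scale0r (0 : H)) hdotZr mul0r normr0 mulr_ge0.
have nv : 0 < `|v| ^+ 2 by rewrite exprn_gt0// normr_gt0.
have := sqr_ge0 `| `|v| ^+ 2 *: u - hdot u v *: v|.
rewrite -scaleNr sqr_normD hdotZl hdotZr !normrZ normrN !exprMn.
rewrite ?normrX !real_normK ?num_real// => D.
rewrite -ler_sqr ?nnegrE ?mulr_ge0// exprMn real_normK ?num_real//.
rewrite -(ler_pM2l nv) -subr_ge0; apply: le_trans D _.
by rewrite le_eqVlt; apply/orP; left; apply/eqP; ring.
Qed.

(* The representing vector minimizes [|v|^2 - 2 L v]; minimizing sequences are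
   Cauchy by the parallelogram identity. *)
Lemma riesz_closed_subspace (S : set H) (L : H -> R) (C : R) :
  S 0 -> (forall (a : R) u v, S u -> S v -> S (a *: u + v)) ->
  (forall (u : nat -> H) v, (forall n, S (u n)) -> u n @[n --> \oo] --> v ->
    S v) ->
  (forall (a : R) u v, L (a *: u + v) = a * L u + L v) ->
  (forall u, `|L u| <= C * `|u|) ->
  exists2 z, S z & forall v, S v -> hdot v z = L v.
Proof.
move=> S0 SP Scl LP Lb.
pose J v : R := `|v| ^+ 2 - 2 * L v.
(* Complete the square: [J v >= |v|^2 - 2 C |v| = (|v| - C)^2 - C^2]. *)
have J_lb v : - C ^+ 2 <= J v.
  have := Lb v; rewrite ler_norml => /andP[_ Lv].
  have := sqr_ge0 (`|v| - C); rewrite /J; nra.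
pose E := [set J v | v in S].
have E_inf : has_inf E.
  split; first by exists (J 0), 0.
  by exists (- C ^+ 2) => _ [v _ <-].
set m := inf E.
have m_le v : S v -> m <= J v.
  by move=> Sv; apply: (ge_inf E_inf.2); exists v.
have /choice[u uP] n : exists v, S v /\ J v < m + n.+1%:R^-1.
  have [|_ [v Sv <-] Jv] := @inf_adherent _ E n.+1%:R^-1 _ E_inf.
    by rewrite invr_gt0.
  by exists v.
have L2 v w : L (v + w) = L v + L w by rewrite -[v]scale1r LP mul1r scale1r.
have L0 : L 0 = 0 by have := L2 0 0; rewrite addr0; lra.
have LZ (a : R) v : L (a *: v) = a * L v by rewrite -[a *: v]addr0 LP L0 addr0.
have parallelogram v w :
    `|v - w| ^+ 2 = 2 * J v + 2 * J w - 4 * J (2^-1 *: v + 2^-1 *: w).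
  rewrite /J -scaleN1r !sqr_normD L2 !LZ !hdotZl !hdotZr !normrZ !exprMn.
  by rewrite normrN1 normfV gtr0_norm//; field.
(* The midpoint of [u i] and [u j] lies in [S], so [J] is at least [m] there, and only the excesses
   of [J (u i)] and [J (u j)] over [m] remain. *)
have u_dist i j : `|u i - u j| ^+ 2 < 2 * i.+1%:R^-1 + 2 * j.+1%:R^-1.
  rewrite parallelogram; have [Si Ji] := uP i; have [Sj Jj] := uP j.
  have mc : m <= J (2^-1 *: u i + 2^-1 *: u j); last first.
    move: Ji Jj mc; move: (J _) (J _) (J _) i.+1%:R^-1 j.+1%:R^-1 => *; lra.
  by apply/m_le/SP => //; rewrite -[_ *: _]addr0; exact: SP.
have /cauchy_cvgP u_cvg : cauchy (u n @[n --> \oo]).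
  apply/cauchyP => e e0.
  have [N _ NP] : \forall n \near \oo, n.+1%:R^-1 < e ^+ 2 / 4.
    have : 0 < e ^+ 2 / 4 by rewrite divr_gt0// exprn_gt0.
    by move=> p; exact: near_infty_natSinv_lt (PosNum p).
  exists (u N); exists N => // n Nn; rewrite -ball_normE /=.
  rewrite -ltr_sqr ?nnegrE ?(ltW e0)//; apply: lt_le_trans (u_dist _ _) _.
  move: (NP _ Nn) (NP N (leqnn N)) => /=.
  move: n.+1%:R^-1 N.+1%:R^-1 => *; lra.
pose z := lim (u n @[n --> \oo]).
have uz : u n @[n --> \oo] --> z by [].
have Sz : S z by apply: Scl uz => n; exact: (uP n).1.
have Jz : J z <= m.
  have Lu : L (u n) @[n --> \oo] --> L z.
    apply/cvgrPdist_le => e e0.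
    (* No sign of [C] is given; [|C| + 1] is a positive Lipschitz constant of [L]. *)
    have C1 : 0 < `|C| + 1 by rewrite ltr_wpDl.
    have : 0 < e / (`|C| + 1) by rewrite divr_gt0.
    move/cvgrPdist_le : uz => /[apply]; apply: filterS => n /= Hn.
    rewrite -[- L _]mulN1r -LZ -L2 scaleN1r; apply: le_trans (Lb _) _.
    rewrite -[e](@divfK _ (`|C| + 1)) ?gt_eqF// mulrC.
    apply: (@le_trans _ _ (`|z - u n| * (`|C| + 1))).
      by rewrite ler_wpM2l// (le_trans (ler_norm C))// lerDl.
    by rewrite ler_wpM2r// ltW.
  have Ju : J (u n) @[n --> \oo] --> J z.
    apply: cvgB; last by apply: cvgMr.
    rewrite expr2; under eq_fun do rewrite expr2.
    by apply: cvgM; apply: cvg_norm.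
  have Jm : m + n.+1%:R^-1 @[n --> \oo] --> m + 0.
    by apply: cvgD; [exact: cvg_cst|exact: cvg_harmonic].
  rewrite -[m]addr0 -(cvg_lim _ Ju)// -(cvg_lim _ Jm)//.
  apply: ler_lim.
  - by apply/cvg_ex; exists (J z).
  - by apply/cvg_ex; exists (m + 0).
  by apply: nearW => n; apply/ltW; exact: (uP n).2.
exists z => // v Sv.
(* First variation: compare [J] at the minimizer [z] and at [t v + z]. *)
have {Jz} J_ge (t : R) : 0 <= t ^+ 2 * `|v| ^+ 2 + 2 * t * (hdot v z - L v).
  have := le_trans Jz (m_le _ (SP t v z Sv Sz)).
  rewrite /J sqr_normD normrZ exprMn real_normK ?num_real// L2 LZ hdotZl; lra.
apply/eqP; rewrite -subr_eq0; apply/eqP; set a := hdot v z - L v.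
(* A step [t] proportional to [- a] makes the quadratic a nonpositive multiple of [a ^+ 2], so
   [a = 0]; the 1 in the denominator covers [v = 0]. *)
have q0 : 0 < `|v| ^+ 2 + 1 by rewrite ltr_wpDl.
have := J_ge (- a / (`|v| ^+ 2 + 1)); rewrite -/a.
have -> : (- a / (`|v| ^+ 2 + 1)) ^+ 2 * `|v| ^+ 2 +
    2 * (- a / (`|v| ^+ 2 + 1)) * a =
    - (a ^+ 2 * ((`|v| ^+ 2 + 2) / (`|v| ^+ 2 + 1) ^+ 2)).
  by field; rewrite gt_eqF.
rewrite oppr_ge0 pmulr_lle0; last by rewrite divr_gt0 ?exprn_gt0// ltr_wpDl.
by move=> a0; apply/eqP; rewrite -sqrf_eq0 eq_le a0 sqr_ge0.
Qed.

(** Riesz representation on [S] of the functional [<., h>] yields the orthogonal projection [z] of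
    [h]; then [h - z] is orthogonal to [S], hence zero. *)
Lemma closed_subspace_dense (S : set H) :
  S 0 -> (forall (a : R) u v, S u -> S v -> S (a *: u + v)) ->
  (forall (u : nat -> H) v, (forall n, S (u n)) -> u n @[n --> \oo] --> v ->
    S v) ->
  (forall h, (forall v, S v -> hdot h v = 0) -> h = 0) ->
  forall h, S h.
Proof.
move=> S0 SP Scl So h.
have [z Sz zP] : exists2 z, S z & forall v, S v -> hdot v z = hdot v h.
  apply: (@riesz_closed_subspace _ _ `|h|) => // [a u v|u].
    by rewrite hdotDl hdotZl.
  by rewrite mulrC cauchy_schwarz.
suff /eqP : h - z = 0 by rewrite subr_eq0 => /eqP ->.
apply: So => v Sv; rewrite hdotC -scaleN1r hdotDr hdotZr zP//; ring.
Qed.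

(** The signs are chosen one at a time, each making the cross term with the sum built so far
    nonpositive. The list is duplicate-free, so fixing the sign at its head leaves the others
    unchanged. *)
Lemma exists_signs (I : finType) (x : I -> H) :
  exists e : I -> R, (forall i, `|e i| = 1) /\
    `|\sum_i e i *: x i| ^+ 2 <= \sum_i `|x i| ^+ 2.
Proof.
suff /(_ (index_enum I) (index_enum_uniq I)) [e [e1 eP]] :
    forall s : seq I, uniq s ->
    exists e : I -> R, (forall i, `|e i| = 1) /\
    `|\sum_(i <- s) e i *: x i| ^+ 2 <= \sum_(i <- s) `|x i| ^+ 2.
  by exists e; split.
elim=> [|a s IH] /=.
  by exists (fun=> 1); split=> [i|]; rewrite ?normr1// !big_nil normr0 expr0n.
move=> /andP[As /IH[e [e1 eP]]]; set y := \sum_(i <- s) e i *: x i in eP.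
pose c : R := if 0 <= hdot (x a) y then -1 else 1.
have c1 : `|c| = 1 by rewrite /c; case: ifP; rewrite ?normrN1 ?normr1.
have cy : c * hdot (x a) y <= 0.
  by rewrite /c; case: ifP => [|/negbT]; rewrite -?ltNge => ?; lra.
exists (fun i => if i == a then c else e i); split=> [i|]; first by case: ifP.
rewrite !big_cons eqxx (eq_big_seq (fun i => e i *: x i)) => [|i si];
  last first.
  by case: eqP => // ia; rewrite ia (negbTE As) in si.
rewrite -/y sqr_normD hdotZl normrZ c1 mul1r.
by move: eP cy; move: (\sum_(i <- s) _) => *; lra.
Qed.

End hilbert_space.

(** * Total variation and integration against signed measures *)

Section total_variation.
Context d (T : measurableType d) (R : realType).
Implicit Types mu nu : {charge set T -> \bar R}.

(** The sets are those of the Hahn decomposition. Bounds on the total variation thus reduce to the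
    values of [mu] on two disjoint sets. *)
Lemma tv_normE mu : exists P N, [/\ measurable P, measurable N, P `&` N = set0 &
  tv_norm mu = fine (mu P) - fine (mu N)].
Proof.
rewrite /tv_norm /Defs.variation; case: (hahn_sets mu) => -[P N] /= h.
have [[mP _] [mN _] PNT PN0] := h; exists P, N; split => //.
rewrite /charge_variation /= /jordan_pos /jordan_neg /=.
rewrite /measure_of_charge /cscale /= /crestr0 !mem_set// /crestr !setTI.
by rewrite mulN1e fineB// fin_num_measure.
Qed.

(** The variation dominates [|mu (A i)|] on each set, and it is a measure, hence additive and
    monotone. *)
Lemma sum_charge_le_tv mu (I : finType) (A : I -> set T) :
  (forall i, measurable (A i)) -> trivIset setT A ->
  \sum_i `|fine (mu (A i))| <= tv_norm mu.
Proof.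
move=> mA tA.
have mU : measurable (\bigcup_i A i).
  by apply: fin_bigcup_measurable => // i _; exact: mA.
rewrite -lee_fin -sumEFin /tv_norm fineK ?fin_num_measure//.
have addm (m : {measure set T -> \bar R}) :
    (m (\bigcup_i A i) = \sum_i m (A i))%E.
  have fI : finite_set [set: I] by exact: finite_finset.
  rewrite content_fin_bigcup// [RHS]fsbig_seq ?index_enum_uniq//.
  by apply: eq_fsbigl; apply/seteqP; split=> i //= _; exact: mem_index_enum.
apply: (@le_trans _ _ (Defs.variation mu (\bigcup_i A i))); last first.
  by apply: le_measure; rewrite ?inE.
rewrite [leRHS]addm; apply: lee_sum => i _.
by rewrite -abse_EFin fineK ?fin_num_measure// abse_charge_variation.
Qed.

Lemma charge_diff_le_tv mu A B : measurable A -> measurable B ->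
  A `&` B = set0 -> fine (mu A) - fine (mu B) <= tv_norm mu.
Proof.
move=> mA mB AB.
have := @sum_charge_le_tv mu bool (fun b => if b then A else B).
rewrite big_bool /=; set x := fine _; set y := fine _ => xy.
have {}xy : `|x| + `|y| <= tv_norm mu.
  apply: xy => [[]//|]; apply/trivIsetP => -[] [] //= _ _ _.
  by rewrite setIC.
by have := ler_norm x; have := ler_norm (- y); rewrite normrN; lra.
Qed.

Lemma charge_le_tv mu A : measurable A -> `|fine (mu A)| <= tv_norm mu.
Proof.
move=> mA; have := @sum_charge_le_tv mu unit (fun=> A).
rewrite big_const card_unit /= addr0; apply => //.
by apply/trivIsetP => -[] [].
Qed.

Lemma tv_norm_ge0 mu : 0 <= tv_norm mu.
Proof. by rewrite (le_trans _ (charge_le_tv mu measurable0)). Qed.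

End total_variation.

(** * Integrals of bounded measurable functions against a signed measure *)

Section cintegral.
Context d (T : measurableType d) (R : realType).
Implicit Types (m : {measure set T -> \bar R}) (mu : {charge set T -> \bar R}).
Variable f : T -> R.
Hypotheses (mf : measurable_fun setT f) (bf : [bounded f x | x in setT]).

Lemma Rintegral_measure_add m1 m2 : (m1 setT < +oo)%E -> (m2 setT < +oo)%E ->
  \int[measure_add m1 m2]_x f x = \int[m1]_x f x + \int[m2]_x f x.
Proof.
move=> m1y m2y.
have i1 := measurable_bounded_integrable measurableT m1y mf bf.
have i2 := measurable_bounded_integrable measurableT m2y mf bf.
have mfE : measurable_fun setT (EFin \o f) by exact/measurable_EFinP.
rewrite /Rintegral integral_measure_add//.
by rewrite fineD// integrable_fin_num.
Qed.

Lemma Rintegral_mscale m (r : {nonneg R}) : (m setT < +oo)%E ->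
  \int[mscale r m]_x f x = r%:num * \int[m]_x f x.
Proof.
move=> my.
have i1 := measurable_bounded_integrable measurableT my mf bf.
rewrite /Rintegral integralE [in RHS]integralE.
have mfE : measurable_fun setT (EFin \o f) by exact/measurable_EFinP.
rewrite !ge0_integral_mscale//;
  [|exact: measurable_funeneg|exact: measurable_funepos].
have fp := integrable_pos_fin_num measurableT i1.
have fn := integrable_neg_fin_num measurableT i1.
by rewrite -muleBr ?fineM// ?fin_num_adde_defr// fin_numB fp fn.
Qed.

(** The integral may be computed from any decomposition into finite measures: with the Jordan parts
    [p] and [n], the measures [m1 + n] and [p + m2] coincide. *)
Lemma cintegralE mu m1 m2 : (m1 setT < +oo)%E -> (m2 setT < +oo)%E ->
  (forall A, measurable A -> mu A = m1 A - m2 A)%E ->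
  cintegral mu f = \int[m1]_x f x - \int[m2]_x f x.
Proof.
move=> m1y m2y muE; rewrite /cintegral.
set p := jordan_pos _; set n := jordan_neg _.
have fin m A : (m setT < +oo)%E -> measurable A -> m A \is a fin_num.
  by move=> my mA; rewrite ge0_fin_numE// (le_lt_trans _ my)// le_measure ?inE.
have py : (p setT < +oo)%E by rewrite ltey_eq fin_num_measure.
have ny : (n setT < +oo)%E by rewrite ltey_eq fin_num_measure.
apply/eqP; rewrite subr_eq addrAC eq_sym subr_eq; apply/eqP.
rewrite -!Rintegral_measure_add//; congr fine.
apply: eq_measure_integral => A mA _.
rewrite [LHS]measure_addE [RHS]measure_addE.
have e : (m1 A - m2 A = p A - n A)%E.
  by rewrite -muE// (jordan_decomp (svalP (hahn_sets mu)) mA) /cadd/= cscaleN1.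
change (m1 A + n A = p A + m2 A)%E.
have pA : p A \is a fin_num by rewrite fin_num_measure.
have nA : n A \is a fin_num by rewrite fin_num_measure.
move: pA nA (fin _ A m1y mA) (fin _ A m2y mA) e.
move: (p A) (n A) (m1 A) (m2 A) => [a||] [b||] [a'||] [b'||]//= _ _ _ _ [ab].
by congr EFin; lra.
Qed.

Lemma cintegral_le_tv mu (C : R) : (forall x, `|f x| <= C) ->
  `|cintegral mu f| <= C * tv_norm mu.
Proof.
move=> fC; rewrite /cintegral; set p := jordan_pos _; set n := jordan_neg _.
have py : (p setT < +oo)%E by rewrite ltey_eq fin_num_measure.
have ny : (n setT < +oo)%E by rewrite ltey_eq fin_num_measure.
have le_C m : (m setT < +oo)%E -> `|\int[m]_x f x| <= C * fine (m setT).
  move=> my; have fi := measurable_bounded_integrable measurableT my mf bf.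
  apply: le_trans (le_normr_Rintegral measurableT fi) _.
  rewrite -Rintegral_cst//; apply: le_Rintegral => //.
    exact: integrable_norm.
  apply: measurable_bounded_integrable => //.
  exact: bounded_cst.
apply: le_trans (ler_normB _ _) _.
apply: le_trans (lerD (le_C _ py) (le_C _ ny)) _.
rewrite -mulrDr /tv_norm /Defs.variation /charge_variation/=.
by rewrite fineD// fin_num_measure.
Qed.

End cintegral.

(** * The total variation norm and the integral on the space of signed measures *)

Section signed_measures.
Context d (T : measurableType d) (R : realType).
Implicit Types mu nu : signed_measure T R.

Definition sm_val mu (A : set T) : R := fine (mu A).

Definition sm_tv mu : R := tv_norm mu.

Lemma sm_valK mu A : (sm_val mu A)%:E = mu A.
Proof. by rewrite fineK// sm_fin_num. Qed.

Lemma sm_valP (a : R) mu nu A :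
  sm_val (a *: mu + nu) A = a * sm_val mu A + sm_val nu A.
Proof.
rewrite /sm_val -[X in fine X = _]/(a%:E * mu A + nu A)%E.
by rewrite fineD ?fin_numM ?sm_fin_num// fineM// sm_fin_num.
Qed.

Lemma sm_valD mu nu A : sm_val (mu + nu) A = sm_val mu A + sm_val nu A.
Proof. by rewrite -[mu]scale1r sm_valP mul1r scale1r. Qed.

Lemma sm_val0 A : sm_val 0 A = 0.
Proof. by []. Qed.

Lemma sm_valZ (a : R) mu A : sm_val (a *: mu) A = a * sm_val mu A.
Proof. by rewrite -[a *: mu]addr0 sm_valP sm_val0 addr0. Qed.

Lemma sm_valB mu nu A : sm_val (mu - nu) A = sm_val mu A - sm_val nu A.
Proof. by rewrite sm_valD -scaleN1r sm_valZ mulN1r. Qed.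

Lemma sm_val_sum (I : finType) (mu : I -> signed_measure T R) A :
  sm_val (\sum_i mu i) A = \sum_i sm_val (mu i) A.
Proof.
elim/big_rec2: _ => [|i x y _ <-]; first exact: sm_val0.
exact: sm_valD.
Qed.

Lemma sm_val_ext mu nu :
  (forall A, measurable A -> sm_val mu A = sm_val nu A) -> mu = nu.
Proof.
by move=> e; apply: signed_measure_ext => A mA; rewrite -!sm_valK e.
Qed.

(** The Hahn sets of [mu + nu] are disjoint test sets for [mu] and for [nu]. *)
Lemma sm_tvD mu nu : sm_tv (mu + nu) <= sm_tv mu + sm_tv nu.
Proof.
have [P [N [mP mN PN e]]] := tv_normE (mu + nu : signed_measure T R).
rewrite [leLHS]e -!/(sm_val _ _) !sm_valD.
have := charge_diff_le_tv mu mP mN PN; have := charge_diff_le_tv nu mP mN PN.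
by rewrite -!/(sm_val _ _) -!/(sm_tv _); lra.
Qed.

Let sm_tvZ_le (a : R) mu : sm_tv (a *: mu) <= `|a| * sm_tv mu.
Proof.
have [P [N [mP mN PN e]]] := tv_normE (a *: mu : signed_measure T R).
rewrite [leLHS]e -!/(sm_val _ _) !sm_valZ -mulrBr.
apply: le_trans (ler_norm _) _; rewrite normrM ler_wpM2l// ler_norml.
rewrite charge_diff_le_tv// andbT lerNl opprB charge_diff_le_tv//.
by rewrite setIC.
Qed.

(** The reverse inequality is [sm_tvZ_le] for the scalar [a^-1] and the measure [a *: mu]. *)
Lemma sm_tvZ (a : R) mu : sm_tv (a *: mu) = `|a| * sm_tv mu.
Proof.
apply/eqP; rewrite eq_le sm_tvZ_le/=.
have [->|a0] := eqVneq a 0; first by rewrite normr0 mul0r tv_norm_ge0.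
rewrite -ler_pdivlMl ?normr_gt0// -normfV -{1}[mu]scale1r -(mulVf a0) -scalerA.
exact: sm_tvZ_le.
Qed.

Let jordan_representation mu : exists p n : {measure set T -> \bar R},
  [/\ (p setT < +oo)%E, (n setT < +oo)%E,
      forall A, measurable A -> mu A = (p A - n A)%E &
      forall f, cintegral mu f = \int[p]_x f x - \int[n]_x f x].
Proof.
pose PN := svalP (hahn_sets mu).
exists (jordan_pos PN), (jordan_neg PN); split => //.
- by rewrite ltey_eq fin_num_measure.
- by rewrite ltey_eq fin_num_measure.
- by move=> A mA; rewrite (jordan_decomp PN mA) /cadd/= cscaleN1.
Qed.

(** For [a >= 0] the combination decomposes as [(a p + p') - (a n + n')]; for [a < 0] the roles of
    [p] and [n] are exchanged, with factor [- a]. Then [cintegralE] applies. *)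
Lemma cintegral_linear (f : T -> R) (a : R) mu nu :
  measurable_fun setT f -> [bounded f x | x in setT] ->
  cintegral (a *: mu + nu : signed_measure T R) f =
  a * cintegral mu f + cintegral nu f.
Proof.
move=> mf bf.
have [p [n [py ny pnE ->]]] := jordan_representation mu.
have [p' [n' [py' ny' pnE' ->]]] := jordan_representation nu.
have fin (m : {measure set T -> \bar R}) A :
    (m setT < +oo)%E -> measurable A -> exists x, m A = x%:E.
  move=> my mA; exists (fine (m A)); rewrite fineK// ge0_fin_numE//.
  by rewrite (le_lt_trans _ my)// le_measure ?inE.
have sy (r : {nonneg R}) (m : {measure set T -> \bar R}) :
    (m setT < +oo)%E -> (mscale r m setT < +oo)%E.
  by move=> my; rewrite /mscale/= lte_mul_pinfty// ?lee_fin// ge0_fin_numE.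
have ay (m1 m2 : {measure set T -> \bar R}) : (m1 setT < +oo)%E ->
    (m2 setT < +oo)%E -> (measure_add m1 m2 setT < +oo)%E.
  by move=> ? ?; rewrite [ltLHS]measure_addE lte_add_pinfty.
have valE A : measurable A ->
    (a *: mu + nu : signed_measure T R) A =
    (a%:E * (p A - n A) + (p' A - n' A))%E.
  by move=> mA; rewrite -pnE// -pnE'//.
have mE (r : {nonneg R}) (m m' : {measure set T -> \bar R}) A :
    (measure_add (mscale r m) m' A = r%:num%:E * m A + m' A)%E.
  exact: measure_addE.
have [a0|a0] := leP 0 a.
  pose r := NngNum a0.
  rewrite (@cintegralE _ _ _ _ mf bf _ (measure_add (mscale r p) p')
    (measure_add (mscale r n) n')); last 1 first.
  - move=> A mA; rewrite valE//.
    rewrite [X in _ = (X - _)%E]mE [X in _ = (_ - X)%E]mE /=.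
    have [x ->] := fin _ A py mA; have [y ->] := fin _ A ny mA.
    have [x' ->] := fin _ A py' mA; have [y' ->] := fin _ A ny' mA.
    by rewrite -!EFinB -!EFinM -!EFinD -?EFinB; congr EFin; ring.
  - rewrite !Rintegral_measure_add ?Rintegral_mscale//=; [ring|exact: sy..].
  - by apply: ay => //; exact: sy.
  - by apply: ay => //; exact: sy.
have {}a0 : 0 <= - a by rewrite oppr_ge0 ltW.
pose r := NngNum a0.
rewrite (@cintegralE _ _ _ _ mf bf _ (measure_add (mscale r n) p')
  (measure_add (mscale r p) n')); last 1 first.
- move=> A mA; rewrite valE//.
  rewrite [X in _ = (X - _)%E]mE [X in _ = (_ - X)%E]mE /=.
  have [x ->] := fin _ A py mA; have [y ->] := fin _ A ny mA.
  have [x' ->] := fin _ A py' mA; have [y' ->] := fin _ A ny' mA.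
  by rewrite -!EFinB -!EFinM -!EFinD -?EFinB; congr EFin; ring.
- rewrite !Rintegral_measure_add ?Rintegral_mscale//=; [ring|exact: sy..].
- by apply: ay => //; exact: sy.
- by apply: ay => //; exact: sy.
Qed.

End signed_measures.

(** * Completeness of the total variation norm *)

Section total_variation_complete.
Context d (T : measurableType d) (R : realType).
Implicit Types mu nu : signed_measure T R.

Lemma near2_nat (P : nat -> nat -> Prop) : (\forall m & n \near \oo, P m n) ->
  exists K, forall m n, (K <= m)%N -> (K <= n)%N -> P m n.
Proof.
move=> [[A B] [[i _ iA] [j _ jB]] AB]; exists (maxn i j) => m n.
rewrite !geq_max => /andP[im _] /andP[_ jn].
by apply: (AB (m, n)); split; [exact: iA|exact: jB].
Qed.

Lemma sm_val_le mu A : `|sm_val mu A| <= sm_tv mu.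
Proof.
have [mA|nA] := pselect (measurable A); first exact: charge_le_tv.
by rewrite /sm_val sm_nonmeasurable// normr0 tv_norm_ge0.
Qed.

Lemma sm_tv_ge0 mu : 0 <= sm_tv mu. Proof. exact: tv_norm_ge0. Qed.

(** The factor 2 counts the two Hahn sets. With [sm_val_le], this makes convergence in total
    variation the same as uniform convergence over all sets. *)
Lemma sm_tv_le mu (e : R) :
  (forall A, `|sm_val mu A| <= e) -> sm_tv mu <= 2 * e.
Proof.
move=> le_e; rewrite /sm_tv; have [P [N [_ _ _ ->]]] := tv_normE mu.
rewrite -!/(sm_val _ _); have := le_e P; have := le_e N.
by rewrite !ler_norml => /andP[? ?] /andP[? ?]; lra.
Qed.

Lemma sm_val_bigsetU mu (F : nat -> set T) n : (forall i, measurable (F i)) ->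
  trivIset setT F ->
  sm_val mu (\big[setU/set0]_(i < n) F i) = \sum_(i < n) sm_val mu (F i).
Proof.
move=> mF tF; apply: EFin_inj; rewrite sm_valK -sumEFin.
rewrite charge_semi_additive//; last exact: bigsetU_measurable.
by apply: eq_bigr => i _; rewrite sm_valK.
Qed.

Lemma sm_val_sigma_additive mu (F : nat -> set T) :
  (forall i, measurable (F i)) -> trivIset setT F ->
  \sum_(i < n) sm_val mu (F i) @[n --> \oo] --> sm_val mu (\bigcup_i F i).
Proof.
move=> mF tF.
have := @charge_semi_sigma_additive _ _ _ mu F mF tF
  (bigcup_measurable (fun i _ => mF i)).
rewrite -[X in _ --> X]sm_valK => /fine_cvg.
rewrite (_ : (fine \o _) = (fun n => \sum_(i < n) sm_val mu (F i)))//.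
apply/funext => n /=; rewrite big_mkord -charge_semi_additive//.
  exact: sm_val_bigsetU.
exact: bigsetU_measurable.
Qed.

Lemma signed_measure_of (l : set T -> R) : l set0 = 0 ->
  (forall F : nat -> set T, (forall i, measurable (F i)) -> trivIset setT F ->
    \sum_(i < n) l (F i) @[n --> \oo] --> l (\bigcup_i F i)) ->
  (forall A, ~ measurable A -> l A = 0) ->
  exists mu : signed_measure T R, forall A, sm_val mu A = l A.
Proof.
move=> l0 ladd lN.
have h0 : (l set0)%:E = 0%E by rewrite l0.
have hfin A : measurable A -> (l A)%:E \is a fin_num by [].
have hadd : semi_sigma_additive (fun A => (l A)%:E).
  move=> F mF tF _.
  rewrite (_ : (fun n => _) = EFin \o (fun n => \sum_(i < n) l (F i))).
    by apply: cvg_EFin; [exact: nearW|exact: ladd].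
  by apply/funext => n /=; rewrite big_mkord sumEFin.
pose c : {charge set T -> \bar R} := HB.pack (fun A => (l A)%:E)
  (@isCharge.Build _ _ _ (fun A => (l A)%:E) h0 hfin hadd).
have cN A : ~ measurable A -> c A = 0%E by move=> /lN /= ->.
by exists (SignedMeasure cN).
Qed.

Lemma sm_tv_complete : complete_norm (@sm_tv _ T R).
Proof.
move=> u u_cauchy.
have {}u_cauchy (e : R) : 0 < e ->
    exists K, forall m n, (K <= m)%N -> (K <= n)%N -> sm_tv (u m - u n) < e.
  by move=> /u_cauchy/near2_nat.
pose l A := lim (sm_val (u n) A @[n --> \oo]).
have ul A : sm_val (u n) A @[n --> \oo] --> l A.
  apply/cauchy_cvgP/cauchyP => e /u_cauchy[K KP].
  exists (sm_val (u K) A); exists K => // n Kn; rewrite -ball_normE /= -sm_valB.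
  by apply: le_lt_trans (sm_val_le _ _) _; exact: KP.
(* Letting [m] tend to infinity in the Cauchy estimate makes the setwise convergence uniform in
   [A]. *)
have unif (e : R) : 0 < e -> exists K, forall n A, (K <= n)%N ->
    `|sm_val (u n) A - l A| <= e.
  move=> e0; have [K KP] := u_cauchy e e0; exists K => n A Kn.
  have ud : `|sm_val (u n) A - sm_val (u m) A| @[m --> \oo] -->
      `|sm_val (u n) A - l A|.
    by apply: cvg_norm; apply: cvgB (ul A); exact: cvg_cst.
  rewrite -(cvg_lim _ ud)//; apply: limr_le.
    by apply/cvg_ex; eexists; exact: ud.
  exists K => // m Km; rewrite -sm_valB.
  by rewrite (le_trans (sm_val_le _ _))// ltW// KP.
have [||A nA|mu muE] := @signed_measure_of l.
- apply/cvg_lim => //; under eq_fun do rewrite /sm_val charge0.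
  exact: cvg_cst.
- move=> F mF tF.
  (* Finite additivity passes to the setwise limit. *)
  have lsum n : \sum_(i < n) l (F i) = l (\big[setU/set0]_(i < n) F i).
    apply/esym/cvg_lim => //; under eq_fun do rewrite sm_val_bigsetU//.
    elim: n => [|n IH].
      rewrite big_ord0 (_ : (fun=> _) = cst 0); first exact: cvg_cst.
      by apply/funext => m; rewrite big_ord0.
    rewrite big_ord_recr/= (_ : (fun m => _) = fun m =>
      \sum_(i < n) sm_val (u m) (F i) + sm_val (u m) (F n)); first exact: cvgD.
    by apply/funext => m; rewrite big_ord_recr.
  (* A single [u K], uniformly within [e / 3] of [l], transfers its countable additivity to [l]. *)
  apply/cvgrPdist_le => e e0; have e3 : 0 < e / 3 by rewrite divr_gt0.
  have [K KP] := unif _ e3.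
  have := @sm_val_sigma_additive (u K) F mF tF.
  move/cvgrPdist_le => /(_ _ e3); apply: filterS => n.
  rewrite lsum -sm_val_bigsetU//.
  have := KP K (\bigcup_i F i) (leqnn K).
  have := KP K (\big[setU/set0]_(i < n) F i) (leqnn K).
  move: (l _) (l _) (sm_val _ _) (sm_val _ _) => a b x y.
  rewrite !ler_norml => /andP[? ?] /andP[? ?] /andP[? ?].
  by apply/andP; split; lra.
- apply/cvg_lim => //; under eq_fun do rewrite /sm_val sm_nonmeasurable//.
  exact: cvg_cst.
exists mu; apply/cvgrPdist_le => e e0.
have e2 : 0 < e / 2 by rewrite divr_gt0.
have [K KP] := unif _ e2; exists K => // n Kn /=.
rewrite sub0r normrN ger0_norm ?sm_tv_ge0//.
rewrite -[e](@divfK _ 2)// mulrC; apply: sm_tv_le => A.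
by rewrite sm_valB muE; exact: KP.
Qed.

End total_variation_complete.

(** * Seminorms *)

Definition seminorm (R : realType) (V : lmodType R) (N : V -> R) :=
  (forall u v, N (u + v) <= N u + N v) /\
  (forall (a : R) v, N (a *: v) = `|a| * N v).

Section seminorms.
Context (R : realType) (V : lmodType R) (N : V -> R).
Hypothesis sN : seminorm N.

Lemma seminorm0 : N 0 = 0.
Proof. by rewrite -(scale0r 0) sN.2 normr0 mul0r. Qed.

Lemma seminormN v : N (- v) = N v.
Proof. by rewrite -scaleN1r sN.2 normrN1 mul1r. Qed.

Lemma seminormB u v : N (u - v) <= N u + N v.
Proof. by rewrite -(seminormN v) sN.1. Qed.

Lemma seminorm_dist u v : `|N u - N v| <= N (u - v).
Proof.
rewrite ler_norml; apply/andP; split.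
  rewrite lerNl opprB lerBlDr -(seminormN (u - v)) opprB.
  by rewrite -{1}(subrK u v) sN.1.
by rewrite lerBlDr -{1}(subrK v u) sN.1.
Qed.

Lemma seminorm_ge0 v : 0 <= N v.
Proof. by have := seminormB v v; rewrite subrr seminorm0; lra. Qed.

Lemma seminorm_sum (I : Type) (r : seq I) (F : I -> V) :
  N (\sum_(i <- r) F i) <= \sum_(i <- r) N (F i).
Proof.
elim/big_rec2: _ => [|i x y _ h]; first by rewrite seminorm0.
by rewrite (le_trans (sN.1 _ _))// lerD2l.
Qed.

End seminorms.

(** * Bases and comparison of norms in finite dimension *)

Section finite_dimension.
Context (R : realType) (V : lmodType R).

(** A spanning family of least size is free: a relation with [c j != 0] would allow [b j] to be
    dropped. *)
Lemma finite_dimensional_basis : finite_dimensional V ->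
  exists (n : nat) (b : 'I_n -> V),
    (forall v, exists c : 'I_n -> R, v = \sum_i c i *: b i) /\
    (forall c : 'I_n -> R, \sum_i c i *: b i = 0 -> forall i, c i = 0).
Proof.
move=> fd.
pose spans n := exists b : 'I_n -> V,
  forall v, exists c : 'I_n -> R, v = \sum_i c i *: b i.
have /ex_minnP[n /asboolP[b bP] nmin] : exists n, `[< spans n >].
  by have [n [b bP]] := fd; exists n; apply/asboolP; exists b.
exists n, b; split=> // c c0 j; apply: contrapT => /eqP cj.
case: n b c j c0 cj bP nmin => [|n] b c j c0 cj bP nmin; first by case: j {cj}.
suff /asboolP/nmin : spans n by rewrite ltnn.
exists (b \o lift j) => v; have [a ->] := bP v.
(* Subtracting [a j / c j] times the relation cancels the coefficient at [j]. *)
exists (fun i => a (lift j i) - a j / c j * c (lift j i)).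
transitivity (\sum_i a i *: b i - (a j / c j) *: \sum_i c i *: b i).
  by rewrite c0 scaler0 subr0.
rewrite scaler_sumr -sumrB (bigD1_ord j)//= scalerA divfK// subrr add0r.
by apply: eq_bigr => i _; rewrite scalerBl scalerA.
Qed.

(** In coordinates, [N1] attains a positive minimum [m] on the compact unit sphere of the sup norm,
    so [m |c| <= N1 (L c)] by homogeneity, while [N2 (L c)] is at most [|c|] times the sum of the
    [N2 (b i)]. *)
Lemma finite_dimensional_norms (N1 N2 : V -> R) : finite_dimensional V ->
  seminorm N1 -> seminorm N2 -> (forall v, N1 v = 0 -> v = 0) ->
  exists2 C, 0 < C & forall v, N2 v <= C * N1 v.
Proof.
move=> /finite_dimensional_basis[n [b [bP b_free]]] s1 s2 N1_eq0.
(* In dimension 0 the unit sphere is empty, so this case is separate. *)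
case: n b bP b_free => [|n] b bP b_free.
  exists 1 => // v; have [c ->] := bP v.
  by rewrite big_ord0 mul1r !seminorm0.
pose L (c : 'rV[R]_n.+1) := \sum_i c 0 i *: b i.
have L_le N (c : 'rV[R]_n.+1) : seminorm N ->
    N (L c) <= `|c| * \sum_i N (b i).
  move=> sN; rewrite (le_trans (seminorm_sum sN _ _))// mulr_sumr.
  apply: ler_sum => i _; rewrite sN.2 ler_wpM2r ?seminorm_ge0//.
  rewrite [leRHS]/Num.norm /= mx_normrE; apply/bigmax_geP; right.
  by exists (0, i).
have LB c c' : L (c - c') = L c - L c'.
  by rewrite /L -sumrB; apply: eq_bigr => i _; rewrite !mxE scalerBl.
pose S := [set c : 'rV[R]_n.+1 | `|c| = 1].
have S0 : S !=set0.
  exists (const_mx 1); rewrite /S /= /Num.norm /= mx_normrE.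
  apply/eqP; rewrite eq_le; apply/andP; split.
    by apply/bigmax_leP; split=> // i _; rewrite mxE normr1.
  by apply/bigmax_geP; right; exists (0, 0) => //=; rewrite mxE normr1.
have S_compact : compact S.
  apply: bounded_closed_compact.
    by exists 1; split=> // x x1 c /= ->; exact: ltW.
  apply: (@closed_comp _ _ (@Num.norm R 'rV[R]_n.+1) [set 1]).
    by move=> c _; exact: norm_continuous.
  exact: closed_eq.
have fc : continuous (N1 \o L).
  move=> c; apply/(@cvgrPdist_le _ _ _ (nbhs c)) => e e0.
  pose B := \sum_i N1 (b i) + 1.
  have B0 : 0 < B by rewrite ltr_wpDl// sumr_ge0// => i _; exact: seminorm_ge0.
  near=> c'; rewrite /= (le_trans (seminorm_dist s1 _ _))// -LB.
  rewrite (le_trans (L_le _ _ s1))//.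
  apply: (@le_trans _ _ (`|c - c'| * B)); first by rewrite ler_wpM2l// lerDl.
  rewrite -ler_pdivlMr//; near: c'.
  by apply: cvgr_dist_le; [exact: cvg_id|rewrite divr_gt0].
have [||c0 + c0_min] := @EVT_min_rV R n.+1 (N1 \o L) S S0.
- exact: S_compact.
- exact: continuous_subspaceT.
rewrite inE => c01; pose m := N1 (L c0).
have m0 : 0 < m.
  rewrite lt_neqAle seminorm_ge0// andbT eq_sym; apply/eqP => /N1_eq0 Lc0.
  have c0i := b_free _ Lc0; have : `|c0| = 0.
    by apply/eqP; rewrite normr_eq0; apply/eqP/rowP => i; rewrite c0i mxE.
  by rewrite c01 => /eqP; rewrite oner_eq0.
have m_le c : m * `|c| <= N1 (L c).
  have [->|cn0] := eqVneq c 0; first by rewrite normr0 mulr0 seminorm_ge0.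
  have nc : 0 < `|c| by rewrite normr_gt0.
  have /c0_min /= : `|c|^-1 *: c \in S.
    by rewrite inE /S /= normrZ normfV normr_id mulVf// gt_eqF.
  have -> : L (`|c|^-1 *: c) = `|c|^-1 *: L c.
    by rewrite /L scaler_sumr; apply: eq_bigr => i _; rewrite mxE scalerA.
  by rewrite s1.2 normfV normr_id ler_pdivlMl// mulrC.
pose B := \sum_i N2 (b i) + 1.
have B0 : 0 < B by rewrite ltr_wpDl// sumr_ge0// => i _; exact: seminorm_ge0.
exists (B / m) => [|v]; first by rewrite divr_gt0.
have [c ->] := bP v; have -> : \sum_i c i *: b i = L (\row_i c i).
  by apply: eq_bigr => i _; rewrite mxE.
rewrite (le_trans (L_le _ _ s2))// -mulrA mulrC.
apply: ler_pM => //; first by apply: sumr_ge0 => i _; exact: seminorm_ge0.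
  by rewrite /B lerDl.
by rewrite ler_pdivlMl.
Unshelve. all: by end_near. Qed.

End finite_dimension.

(** * The open mapping theorem for a complete norm [N] *)

Section open_mapping.
Context (R : realType) (V : lmodType R) (H : completeNormedModType R).
Variables (N : V -> R) (f : V -> H) (B : R).
Hypotheses (sN : seminorm N) (cN : complete_norm N).
Hypotheses (f_lin : forall (a : R) u v, f (a *: u + v) = a *: f u + f v).
Hypotheses (f_bd : forall v, `|f v| <= B * N v).
Hypotheses (f_surj : forall h, exists v, f v = h).

Let fD u v : f (u + v) = f u + f v.
Proof. by rewrite -[u]scale1r f_lin !scale1r. Qed.

Let f0 : f 0 = 0.
Proof. by have /eqP := fD 0 0; rewrite addr0 -subr_eq subrr => /eqP. Qed.

Let fZ (a : R) u : f (a *: u) = a *: f u.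
Proof. by rewrite -[a *: u]addr0 f_lin f0 addr0. Qed.

Let fB u v : f (u - v) = f u - f v.
Proof. by rewrite fD -scaleN1r fZ scaleN1r. Qed.

(** By surjectivity the images [F n] of the [N]-balls cover [H], so by Baire the closure of some
    [F n] contains a ball. Translation and scaling give approximate preimages of every [h]. *)
Let approximation : exists2 C, 0 < C & forall h e, 0 < e -> exists v,
  N v <= C * `|h| /\ `|h - f v| <= e.
Proof.
pose F n := [set f v | v in [set v | N v <= n%:R]].
have [n nd] : exists n, ~ dense (~` closure (F n)).
  apply: contrapT => /forallNP/(_ _)/contrapT dF.
  have : dense (\bigcap_n (~` closure (F n))).
    apply: Baire => i; split; last exact: dF.
    exact/closed_openC/closed_closure.
  move=> /(_ setT) -[||h [_ hF]]; [by exists 0|exact: openT|].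
  have [v vh] := f_surj h; apply: (hF (Num.truncn (N v)).+1 Logic.I).
  by apply: subset_closure; exists v => //=; rewrite ltW// truncnS_gt.
have [W [[a /open_nbhs_nbhs/nbhs_ballP[r /= r0 arW]] /disjoints_subset WF]] :=
  denseNE nd.
(* The ball of radius [r] at [a] lies in the closure of [F n]; subtracting approximate preimages of
   [a + h] and [a] recentres it at 0. *)
have approx h e : `|h| < r -> 0 < e ->
    exists v, N v <= n%:R *+ 2 /\ `|h - f v| <= e.
  move=> hr e0; have e2 : 0 < e / 2 by rewrite divr_gt0.
  have cl x : ball a r x -> exists v, N v <= n%:R /\ `|x - f v| < e / 2.
    move=> /arW /WF; rewrite setCK => /(_ (ball x (e / 2))) [].
      exact: nbhsx_ballx.
    by move=> _ [[v Nv <-] xv]; exists v; split=> //; rewrite -ball_normE in xv.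
  have [|v1 [N1 h1]] := cl (a + h).
    by rewrite -ball_normE /= opprD addrA subrr sub0r normrN.
  have [|v2 [N2 h2]] := cl a; first exact: ballxx.
  exists (v1 - v2); split.
    by rewrite (le_trans (seminormB sN _ _))// mulr2n lerD.
  rewrite fB (_ : h - _ = (a + h - f v1) - (a - f v2)); last first.
    rewrite !opprB [a + h]addrC -!addrA; congr (h + _).
    by rewrite [RHS]addrCA addrC; congr (_ + _); rewrite addrCA subrr addr0.
  by rewrite (le_trans (ler_normB _ _))// [e]splitr lerD// ltW.
(* Scaling [h] to norm [r / 2] and back turns the bound [2 n] into [4 n |h| / r]; the added 1 keeps
   the constant positive when [n = 0]. *)
exists (n%:R * 4 / r + 1) => [|h e e0].
  by rewrite ltr_wpDl// divr_ge0 ?mulr_ge0// ltW.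
have [->|h0] := eqVneq h 0.
  exists 0; rewrite seminorm0// f0 subr0 normr0 mulr0.
  by split=> //; exact: ltW.
have nh : 0 < `|h| by rewrite normr_gt0.
pose t := r / (2 * `|h|).
have t0 : 0 < t by rewrite divr_gt0// mulr_gt0.
have th : t * `|h| = r / 2 by rewrite /t; field; rewrite gt_eqF.
have [| |v [Nv vh]] := approx (t *: h) (t * e).
- by rewrite normrZ gtr0_norm// th ltr_pdivrMr// ltr_pMr// ltr1n.
- exact: mulr_gt0.
exists (t^-1 *: v); split.
  rewrite sN.2 normfV gtr0_norm//.
  rewrite ler_pdivrMl// (le_trans Nv)// mulrCA th.
  rewrite (_ : _ * (r / 2) = n%:R *+ 2 + r / 2) ?lerDl ?divr_ge0 ?ltW//.
  by field; rewrite gt_eqF.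
rewrite fZ -[h](scale1r) -(mulVf (lt0r_neq0 t0)) -scalerA -scalerBr normrZ.
by rewrite normfV gtr0_norm// ler_pdivrMl.
Qed.

(** Successive correction: [s] adds an approximate preimage of the current error, which halves at
    each step. The increments are bounded by a geometric series of sum [2 C |h|], so [s] converges
    for [N], and [f] maps its limit to [h]. *)
Lemma open_mapping : exists2 C, 0 < C & forall h, exists v,
  f v = h /\ N v <= C * `|h|.
Proof.
have [C C0 approx] := approximation.
have /choice[g gP] h : exists v, N v <= C * `|h| /\ `|h - f v| <= `|h| / 2.
  have [->|h0] := eqVneq h 0.
    by exists 0; rewrite seminorm0// f0 subr0 normr0 mulr0 mul0r; split.
  by apply: approx; rewrite divr_gt0// normr_gt0.
exists (2 * C) => [|h]; first by rewrite mulr_gt0.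
pose s := fix s n := if n is m.+1 then s m + g (h - f (s m)) else 0 : V.
pose q : R := 2^-1.
have hs n : `|h - f (s n)| <= `|h| * q ^+ n.
  elim: n => [|n IH] /=; first by rewrite f0 subr0 mulr1.
  rewrite fD opprD addrA (le_trans (gP _).2)// exprSr mulrA.
  by rewrite ler_wpM2r// invr_ge0.
(* The geometric sum is kept in telescoped form so that the induction on [k] closes. *)
have Ns n k : N (s (n + k)%N - s n) <= 2 * C * `|h| * (q ^+ n - q ^+ (n + k)).
  elim: k => [|k IH]; first by rewrite addn0 subrr seminorm0// subrr mulr0.
  rewrite addnS /= addrAC (le_trans (sN.1 _ _))//.
  rewrite (le_trans (lerD IH (gP _).1))//.
  have := hs (n + k)%N; rewrite -(ler_pM2l C0) => h1.
  apply: le_trans (lerD (lexx _) h1) _.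
  by rewrite exprS /q le_eqVlt; apply/orP; left; apply/eqP; field.
have q0 n : 0 < q ^+ n by rewrite exprn_gt0// invr_gt0.
have K0 : 0 <= 2 * C * `|h| by rewrite mulr_ge0// mulr_ge0// ltW.
have Ns' n k : N (s (n + k)%N - s n) <= 2 * C * `|h| * q ^+ n.
  by rewrite (le_trans (Ns n k))// ler_wpM2l// lerBlDr lerDl ltW.
have qlim (K : R) : K * q ^+ n @[n --> \oo] --> 0.
  rewrite -(mulr0 K); apply: cvgMr; apply: cvg_expr.
  by rewrite ger0_norm ?invr_ge0// invf_lt1// ltr1n.
have [e e0|l sl] := cN (u := s).
  have e2 : 0 < e / 2 by rewrite divr_gt0.
  have /cvgrPdist_lt/(_ _ e2)[K _ KP] := qlim (2 * C * `|h|).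
  exists ([set n | (K <= n)%N], [set n | (K <= n)%N]).
    by split; exists K.
  move=> [m n] /= [Km Kn].
  have dK j : (K <= j)%N -> N (s j - s K) < e / 2.
    move=> Kj; rewrite -(subnKC Kj) (le_lt_trans (Ns' _ _))//.
    have := KP K (leqnn K); rewrite /= sub0r normrN; apply: le_lt_trans.
    exact: ler_norm.
  rewrite (_ : s m - s n = (s m - s K) - (s n - s K)); last first.
    by rewrite opprB subrKA.
  by rewrite (le_lt_trans (seminormB sN _ _))// [e]splitr ltrD// dK.
exists l; split.
  apply/eqP; rewrite eq_sym -subr_eq0 -normr_eq0 eq_le normr_ge0 andbT.
  have lim0 : `|h| * q ^+ n + B * N (s n - l) @[n --> \oo] --> 0 + B * 0.
    by apply: cvgD; [exact: qlim|apply: cvgMr].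
  rewrite mulr0 addr0 in lim0.
  apply: ler_cvg_to (cvg_cst _) lim0 _; apply: nearW => n.
  rewrite (_ : h - f l = (h - f (s n)) + f (s n - l)); last first.
    by rewrite fB subrKA.
  by rewrite (le_trans (ler_normD _ _))// lerD.
have lim1 : 2 * C * `|h| + N (s n - l) @[n --> \oo] --> 2 * C * `|h| + 0.
  by apply: cvgD sl; exact: cvg_cst.
rewrite -[leRHS]addr0; apply: ler_cvg_to (cvg_cst _) lim1 _; apply: nearW => n.
rewrite -{1}(subKr (s n) l) (le_trans (seminormB sN _ _))// lerD2r.
have := Ns' 0%N n; rewrite add0n subr0 => /le_trans; apply.
by rewrite mulr1.
Qed.

End open_mapping.

(** * Dirac measures and atoms *)

Section dirac_signed_measure.
Context d (T : measurableType d) (R : realType).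

(** Restricting to the whole space through [crestr0] resets the values on nonmeasurable sets to 0,
    as [signed_measure] demands. *)
Let dirac_charge (x : T) : {charge set T -> \bar R} :=
  crestr0 (charge_of_finite_measure (\d_x : set T -> \bar R)) measurableT.

Let dirac_nonmeasurable x A : ~ measurable A -> dirac_charge x A = 0%E.
Proof. by move=> nA; rewrite /= /crestr0 memNset. Qed.

Definition sm_dirac (x : T) : signed_measure T R :=
  SignedMeasure (@dirac_nonmeasurable x).

Lemma sm_diracE x A : measurable A -> sm_dirac x A = (\d_x A : \bar R).
Proof. by move=> mA; rewrite /= /crestr0 mem_set// /crestr setIT. Qed.

Lemma sm_val_dirac x A : measurable A -> sm_val (sm_dirac x) A = (x \in A)%:R.
Proof. by move=> mA; rewrite /sm_val sm_diracE// diracE. Qed.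

Lemma cintegral_dirac (f : T -> R) x :
  measurable_fun setT f -> [bounded f x | x in setT] ->
  cintegral (sm_dirac x) f = f x.
Proof.
move=> mf bf.
rewrite (@cintegralE _ _ _ f mf bf _ (\d_x : set T -> \bar R) mzero).
- rewrite /Rintegral integral_dirac//; last exact/measurable_EFinP.
  by rewrite diracT mul1e integral_measure_zero subr0.
- by rewrite [ltLHS]diracT ltry.
- by rewrite /mzero ltry.
- by move=> A mA; rewrite sm_diracE// [X in (_ - X)%E](_ : _ = 0%E) ?sube0.
Qed.

End dirac_signed_measure.
Arguments sm_dirac {d T} R x.

(** * Disjoint measurable families and the dimension of the space of signed measures *)

Section disjoint_families.
Context d (T : measurableType d) (R : realType).

(** Any finite index type is allowed, so that [option I] can index a family with one more member. *)
Definition has_disjoint_family (n : nat) :=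
  exists (I : finType) (A : I -> set T), [/\ #|I| = n,
    forall i, measurable (A i), trivIset setT A & forall i, A i !=set0].

Lemma sm_val_partition (mu : signed_measure T R) (I : finType)
    (A : I -> set T) (B : set T) :
  (forall i, measurable (A i)) -> trivIset setT A ->
  (forall x, B x -> exists i, A i x) -> measurable B ->
  sm_val mu B = \sum_i sm_val mu (B `&` A i).
Proof.
move=> mA tA BA mB.
have sumU (r : seq I) : uniq r ->
    measurable (\big[setU/set0]_(i <- r) (B `&` A i)) /\
    sm_val mu (\big[setU/set0]_(i <- r) (B `&` A i)) =
    \sum_(i <- r) sm_val mu (B `&` A i).
  elim: r => [_|i r IH /= /andP[ir /IH[mr er]]].
    by rewrite !big_nil /sm_val charge0.
  have mi : measurable (B `&` A i) by exact: measurableI.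
  rewrite !big_cons -er; split; first exact: measurableU.
  rewrite /sm_val chargeU ?fineD ?sm_fin_num//.
  rewrite -subset0 => x [[_ Aix]]; rewrite -bigcup_seq => -[j /= jr [_ Ajx]].
  have ij : i = j by apply: tA => //; exists x.
  by rewrite ij jr in ir.
have [_] := sumU _ (index_enum_uniq I).
rewrite -bigcup_seq => <-; congr (sm_val mu _); apply/seteqP; split=> x.
  by move=> Bx; have [i Aix] := BA x Bx; exists i => //=; exact: mem_index_enum.
by move=> [i _ []].
Qed.

(* A maximal family of disjoint nonempty measurable sets consists of the atoms
   of the sigma-algebra, and then any signed measure is a combination of Dirac
   measures at points of these atoms. *)
Lemma disjoint_families_or_finite_dimensional :
  (forall n, has_disjoint_family n) \/
  finite_dimensional (signed_measure T R).
Proof.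
have [|/existsNP nP] := pselect (forall n, has_disjoint_family n).
  by left.
(* The least size without a family is not 0, because of the empty family; hence it is [m.+1], and
   size [m] is attained. *)
right; have /ex_minnP[[|m] /asboolP + mmin] :
    exists n, `[< ~ has_disjoint_family n >].
- by have [n Pn] := nP; exists n; apply/asboolP.
- case; exists void, (fun=> set0); split; [exact: card_void|by case|..].
    by apply/trivIsetP => -[].
  by case.
move=> Pm1; have [I [A [cI mA tA A0]]] : has_disjoint_family m.
  apply: contrapT => /asboolP/mmin; by rewrite ltnn.
(* Otherwise [D] and the sets [A i] minus [D] would form a family of size [m.+1]. *)
have atom D : measurable D -> D !=set0 -> exists i, A i `<=` D.
  move=> mD D0; apply: contrapT => /forallNP AD; apply: Pm1.
  exists (option I), (fun o => if o is Some i then A i `\` D else D); split.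
  - by rewrite card_option cI.
  - by case=> [i|//]; exact: measurableD.
  - apply/trivIsetP => -[i|] [j|]//= _ _ ij.
    + rewrite -subset0 => x [[Aix _] [Ajx _]]; move: ij.
      by rewrite (tA i j)//; [rewrite eqxx|exists x].
    + by rewrite -subset0 => x [[_ nDx] Dx].
    + by rewrite -subset0 => x [Dx [_ nDx]].
  - case=> [i|//]; have /existsNP[x /not_implyP[Aix nDx]] := AD i.
    by exists x.
have /choice[x Ax] := A0.
have coverA y : exists i, A i y.
  apply: contrapT => ny.
  have [||i] := atom (~` \bigcup_i A i).
  - by apply: measurableC; apply: fin_bigcup_measurable => // i _; exact: mA.
  - by exists y => -[i _ Aiy]; apply: ny; exists i.
  - by move=> /(_ _ (Ax i)); apply; exists i.
exists #|I|, (fun i => sm_dirac R (x (enum_val i))) => mu.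
exists (fun i => sm_val mu (A (enum_val i))).
rewrite -(big_enum_val (fun i => sm_val mu (A i) *: sm_dirac R (x i))) /=.
apply: sm_val_ext => B mB; rewrite sm_val_sum.
rewrite (@sm_val_partition mu I A)//; apply: eq_bigr => i _.
rewrite sm_valZ sm_val_dirac//.
(* If [B] meets [A i], their intersection contains some [A j], and disjointness forces [j = i]: thus
   [B] contains [A i] or misses it. *)
have [[y BAy]|BA0] := pselect (B `&` A i !=set0).
  have [||j Aj] := atom (B `&` A i); [exact: measurableI|by exists y|].
  have ij : i = j.
    by apply: tA => //; exists (x j); split=> //; exact: (Aj _ (Ax j)).2.
  have AB : B `&` A i = A i.
    by apply/seteqP; split=> z; [case|rewrite {1}ij => /Aj].
  rewrite AB mem_set ?mulr1//; apply: (Aj (x i) _).1.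
  by rewrite -ij.
have -> : B `&` A i = set0.
  by apply/eqP/negPn/negP => /set0P.
rewrite /sm_val charge0 memNset ?mulr0// => Bx; apply: BA0.
by exists (x i).
Qed.

End disjoint_families.

(** * The kernel embedding *)

Section kernel_embedding.
Context d (T : measurableType d) (R : realType) (k : T -> T -> R) (H : rkhs k).
Hypothesis mk : measurable_fun [set: T * T] (fun p : T * T => k p.1 p.2).
Hypothesis bk : [bounded k p.1 p.2 | p in [set: T * T]].
Implicit Types (h : H) (mu : signed_measure T R).

Local Notation section := (@rkhs_section _ _ _ H).
Local Notation Phi := (@kernel_embedding d T R k H).

(** By the reproducing property, the squared norm of [k(., x)] is [k(x, x)]. *)
Lemma rkhs_section_bounded : exists2 B : R, 0 < B & forall x, `|section x| <= B.
Proof.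
have [M [_ MP]] := bk; pose M' := `|M| + 1.
have M'0 : 0 < M' by rewrite ltr_wpDl.
exists (Num.sqrt M') => [|x]; first by rewrite sqrtr_gt0.
rewrite norm_hdot ler_wsqrtr// rkhs_reproducing rkhs_sectionE.
have /MP/(_ (x, x) Logic.I) /= : M < M' by rewrite /M' ltr_pwDr// ler_norm.
exact/le_trans/ler_norm.
Qed.

Lemma rkhs_fun_le h x : `|rkhs_fun h x| <= `|h| * `|section x|.
Proof. by rewrite -rkhs_reproducing cauchy_schwarz. Qed.

Lemma rkhs_fun_bounded h : [bounded rkhs_fun h x | x in setT].
Proof.
have [B B0 BP] := rkhs_section_bounded.
exists (`|h| * B); split=> [|M hM x _]; first exact: num_real.
apply/ltW; apply: le_lt_trans hM.
by rewrite (le_trans (rkhs_fun_le h x))// ler_wpM2l.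
Qed.

(** Norm convergence implies pointwise convergence, so the elements with measurable function form a
    closed subspace. It contains every [k(., x)], hence it is all of [H]. *)
Lemma rkhs_fun_measurable h : measurable_fun setT (rkhs_fun h).
Proof.
move: h; apply: (closed_subspace_dense
  (S := fun h => measurable_fun setT (rkhs_fun h))).
- rewrite (_ : rkhs_fun _ = cst 0)//; apply/funext => x /=.
  by rewrite -rkhs_reproducing -(scale0r (0 : H)) hdotZl mul0r.
- move=> a u v mu mv.
  rewrite (_ : rkhs_fun _ = (fun x => a * rkhs_fun u x + rkhs_fun v x)).
    by apply: measurable_funD => //; exact: measurable_funM.
  by apply/funext => x; rewrite rkhs_fun_linear.
- move=> u v mu uv; apply/measurable_EFinP.
  apply: (@emeasurable_fun_cvg _ _ _ _ (fun n => EFin \o rkhs_fun (u n))).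
    by move=> n; exact/measurable_EFinP/mu.
  move=> x _; apply: cvg_EFin; first exact: nearW.
  apply/cvgrPdist_le => e e0; pose B := `|section x| + 1.
  have B0 : 0 < B by rewrite ltr_wpDl.
  have : 0 < e / B by rewrite divr_gt0.
  move/cvgrPdist_le : uv => /[apply]; apply: filterS => n /= un.
  rewrite -!rkhs_reproducing -[- hdot _ _]mulN1r -hdotZl -hdotDl scaleN1r.
  rewrite (le_trans (cauchy_schwarz _ _))//.
  apply: (@le_trans _ _ (`|v - u n| * B)); first by rewrite ler_wpM2l// lerDl.
  by rewrite -ler_pdivlMr.
- move=> h h_ortho; apply: (@rkhs_fun_inj _ _ _ H); apply/funext => x.
  rewrite -!rkhs_reproducing h_ortho; last first.
    rewrite (_ : rkhs_fun _ = (fun y => k y x)).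
      exact: (measurableT_comp mk (pair2_measurable x)).
    by apply/funext => y; rewrite rkhs_sectionE.
  by rewrite -(scale0r (0 : H)) hdotZl mul0r.
Qed.

Lemma hdot_sectionE h : (fun x => hdot h (section x)) = rkhs_fun h.
Proof. by apply/funext => x; rewrite rkhs_reproducing. Qed.

Lemma rkhs_fun_integrable (m : {measure set T -> \bar R}) h :
  (m setT < +oo)%E -> m.-integrable setT (EFin \o rkhs_fun h).
Proof.
move=> my; apply: measurable_bounded_integrable => //.
  exact: rkhs_fun_measurable.
exact: rkhs_fun_bounded.
Qed.

Lemma cintegral_rkhs_fun_linear mu (a : R) (g h : H) :
  cintegral mu (rkhs_fun (a *: g + h)) =
  a * cintegral mu (rkhs_fun g) + cintegral mu (rkhs_fun h).
Proof.
rewrite /cintegral; set p := jordan_pos _; set n := jordan_neg _.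
have lin (m : {measure set T -> \bar R}) : (m setT < +oo)%E ->
    \int[m]_x rkhs_fun (a *: g + h) x =
    a * \int[m]_x rkhs_fun g x + \int[m]_x rkhs_fun h x.
  move=> my; have ig := rkhs_fun_integrable g my.
  have ih := rkhs_fun_integrable h my.
  under eq_Rintegral do rewrite rkhs_fun_linear.
  have iag : m.-integrable setT (EFin \o (fun x => a * rkhs_fun g x)).
    exact: (integrableZl measurableT a ig).
  rewrite RintegralD//.
  by rewrite RintegralZl.
have py : (p setT < +oo)%E by rewrite ltey_eq fin_num_measure.
have ny : (n setT < +oo)%E by rewrite ltey_eq fin_num_measure.
by rewrite (lin _ py) (lin _ ny); ring.
Qed.

(** Riesz representation of the bounded functional [h |-> \int h dmu] on all of [H] provides a
    Pettis integral, so [xget] does not fall back on its default. *)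
Lemma kernel_embedding_pettis mu : is_pettis_integral mu section (Phi mu).
Proof.
apply: (@xgetPex _ _ [set z : H | is_pettis_integral mu section z]).
have [B B0 BP] := rkhs_section_bounded.
have [|||||z _ zP] := @riesz_closed_subspace _ H setT
  (fun h => cintegral mu (rkhs_fun h)) (B * tv_norm mu) => //.
- by move=> a u v; exact: cintegral_rkhs_fun_linear.
- move=> h; rewrite mulrAC (mulrC B).
  apply: cintegral_le_tv; [exact: rkhs_fun_measurable|exact: rkhs_fun_bounded|].
  by move=> x; rewrite (le_trans (rkhs_fun_le h x))// ler_wpM2l.
exists z => h; rewrite hdot_sectionE; split; last exact: zP.
under eq_fun do rewrite rkhs_reproducing.
by apply: rkhs_fun_integrable; rewrite ltey_eq fin_num_measure.
Qed.

Lemma hdot_kernel_embedding mu h : hdot h (Phi mu) = cintegral mu (rkhs_fun h).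
Proof. by rewrite (kernel_embedding_pettis mu h).2 hdot_sectionE. Qed.

Lemma hdot_ext (u v : H) : (forall h, hdot h u = hdot h v) -> u = v.
Proof.
move=> uv; apply/eqP; rewrite -subr_eq0 -normr_eq0 -sqrf_eq0 -hdot_normE.
by rewrite -[- v]scaleN1r hdotDr hdotZr uv mulN1r subrr.
Qed.

Lemma kernel_embedding_linear (a : R) mu nu :
  Phi (a *: mu + nu) = a *: Phi mu + Phi nu.
Proof.
apply: hdot_ext => h; rewrite hdotDr hdotZr !hdot_kernel_embedding.
apply: cintegral_linear; [exact: rkhs_fun_measurable|exact: rkhs_fun_bounded].
Qed.

Lemma kernel_embedding_dirac x : Phi (sm_dirac R x) = section x.
Proof.
apply: hdot_ext => h; rewrite hdot_kernel_embedding rkhs_reproducing.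
rewrite cintegral_dirac//; first exact: rkhs_fun_measurable.
exact: rkhs_fun_bounded.
Qed.

(** Testing the Pettis identity on [h = Phi mu] bounds [|Phi mu|^2] by [B |Phi mu|] times the total
    variation. The same [B] also bounds the sections. *)
Lemma kernel_embedding_bounded : exists2 B : R, 0 < B &
  (forall x, `|section x| <= B) /\ (forall mu, `|Phi mu| <= B * sm_tv mu).
Proof.
have [B B0 BP] := rkhs_section_bounded; exists B => //; split=> // mu.
have [->|Phi0] := eqVneq (Phi mu) 0.
  by rewrite normr0 mulr_ge0 ?sm_tv_ge0// ltW.
rewrite -(@ler_pM2l _ `|Phi mu|) ?normr_gt0// -expr2 -hdot_normE.
rewrite hdot_kernel_embedding mulrA (le_trans (ler_norm _))//.
apply: cintegral_le_tv; [exact: rkhs_fun_measurable|exact: rkhs_fun_bounded|].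
by move=> x; rewrite (le_trans (rkhs_fun_le _ x))// ler_wpM2l.
Qed.

End kernel_embedding.

(** * The four implications *)

Section equivalences.
Context d (T : measurableType d) (R : realType) (k : T -> T -> R) (H : rkhs k).
Hypothesis mk : measurable_fun [set: T * T] (fun p : T * T => k p.1 p.2).
Hypothesis bk : [bounded k p.1 p.2 | p in [set: T * T]].

Local Notation V := (signed_measure T R).
Local Notation Phi := (@kernel_embedding d T R k H).

Let PhiP := kernel_embedding_linear H mk bk.

Let Phi0 : Phi 0 = 0.
Proof.
have := PhiP 1 0 0; rewrite !scale1r addr0 => /eqP.
by rewrite -subr_eq subrr => /eqP.
Qed.

Let PhiZ (a : R) (mu : V) : Phi (a *: mu) = a *: Phi mu.
Proof. by rewrite -[a *: mu]addr0 PhiP Phi0 addr0. Qed.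

Let PhiD (mu nu : V) : Phi (mu + nu) = Phi mu + Phi nu.
Proof. by rewrite -[mu]scale1r PhiP !scale1r. Qed.

Let PhiB (mu nu : V) : Phi (mu - nu) = Phi mu - Phi nu.
Proof. by rewrite PhiD -scaleN1r PhiZ scaleN1r. Qed.

Let Phi_sum (I : finType) (mu : I -> V) : Phi (\sum_i mu i) = \sum_i Phi (mu i).
Proof. by elim/big_rec2: _ => [|i x y _ <-]; [exact: Phi0|exact: PhiD]. Qed.

Let seminorm_tv : seminorm (@sm_tv _ T R).
Proof. by split; [exact: sm_tvD|exact: sm_tvZ]. Qed.

Lemma seminorm_rkhs_norm : seminorm (rkhs_norm H).
Proof.
split=> [u v|a v]; rewrite /rkhs_norm ?PhiD ?PhiZ; first exact: ler_normD.
exact: normrZ.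
Qed.

(** Boundedness of [Phi] gives the constant [B^-1]; injectivity makes the norm of [H] definite, so
    finite dimension gives the other bound. *)
Lemma finite_dimensional_equivalent_norms : injective Phi ->
  finite_dimensional V -> equivalent_norms (rkhs_norm H) (@sm_tv _ T R).
Proof.
move=> Phi_inj fd.
have [B B0 [_ Phi_le]] := kernel_embedding_bounded H mk bk.
have [|C C0 CP] := finite_dimensional_norms fd seminorm_rkhs_norm seminorm_tv.
  by move=> mu /eqP; rewrite /rkhs_norm normr_eq0 -Phi0 => /eqP/Phi_inj.
exists B^-1, C; split=> // [|mu]; first by rewrite invr_gt0.
by split; [rewrite ler_pdivrMl//; exact: Phi_le|exact: CP].
Qed.

Lemma equivalent_norms_complete :
  equivalent_norms (rkhs_norm H) (@sm_tv _ T R) -> complete_norm (rkhs_norm H).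
Proof.
move=> [c [C [c0 C0 cC]]] u u_cauchy.
have [e e0|l ul] := @sm_tv_complete d T R u.
  have := u_cauchy (e / C); rewrite divr_gt0// => /(_ isT).
  apply: filterS => -[m n] /= mn; apply: le_lt_trans (cC _).2 _.
  by rewrite -ltr_pdivlMl// mulrC.
exists l; have lim0 : c^-1 * sm_tv (u n - l) @[n --> \oo] --> c^-1 * 0.
  exact: cvgMr.
rewrite mulr0 in lim0; apply: squeeze_cvgr (cvg_cst 0) lim0.
apply: nearW => n; rewrite normr_ge0/= ler_pdivlMl//.
exact: (cC _).1.
Qed.

(* The range is closed and contains all [k(., x)], whose orthogonal complement
   is trivial by the reproducing property. *)
Lemma complete_surjective : complete_norm (rkhs_norm H) ->
  forall h : H, exists mu : V, Phi mu = h.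
Proof.
move=> cN; apply: (closed_subspace_dense
  (S := fun h => exists mu : V, Phi mu = h)).
- by exists 0.
- by move=> a _ _ [mu <-] [nu <-]; exists (a *: mu + nu); rewrite PhiP.
(* [Phi] is isometric for [rkhs_norm], so preimages of a convergent sequence are Cauchy, and [Phi]
   sends their limit to [v]. *)
- move=> w v /choice[u uw] wv.
  have [e e0|l ul] := cN u.
    have near_v : \forall n \near \oo, `|v - w n| < e / 2.
      by move/cvgrPdist_lt : wv; apply; rewrite divr_gt0.
    exists ([set n | `|v - w n| < e / 2], [set n | `|v - w n| < e / 2]) => //.
    move=> [m n] /= [vm vn]; rewrite /rkhs_norm PhiB !uw.
    rewrite (le_lt_trans (ler_distD v _ _))// [e]splitr ltrD//.
    by rewrite distrC.
  have wl : w n @[n --> \oo] --> Phi l.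
    apply/cvgrPdist_le => e e0; move/cvgrPdist_le : ul => /(_ e e0).
    apply: filterS => n; rewrite sub0r normrN /rkhs_norm normr_id PhiB uw.
    by rewrite distrC.
  by exists l; rewrite -(cvg_lim _ wl)// -(cvg_lim _ wv).
- move=> h h0; apply: (@rkhs_fun_inj _ _ _ H); apply/funext => x.
  rewrite -!rkhs_reproducing h0; last first.
    by exists (sm_dirac R x); exact: kernel_embedding_dirac.
  by rewrite -(scale0r (0 : H)) hdotZl mul0r.
Qed.

(* For points [x i] separated by [n] disjoint sets, a suitable combination
   [\sum_i e i *: \d_(x i)] with signs [e i] has total variation at least [n]
   but norm at most [B * sqrt n] in [H]. *)
Lemma surjective_finite_dimensional : injective Phi ->
  (forall h : H, exists mu : V, Phi mu = h) -> finite_dimensional V.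
Proof.
move=> Phi_inj Phi_surj.
have [B B0 [sB Phi_le]] := kernel_embedding_bounded H mk bk.
have [C C0 CP] :=
  open_mapping seminorm_tv (@sm_tv_complete d T R) PhiP Phi_le Phi_surj.
(* By injectivity, the controlled preimage of [Phi mu] is [mu] itself. *)
have tv_le mu : sm_tv mu <= C * `|Phi mu|.
  by have [nu [/Phi_inj ->]] := CP (Phi mu).
(* Used with [q = n] and [p = |Phi mu|]: squaring gives [q^2 <= c^2 p^2 <= (c b)^2 q], against
   [q > (c b)^2]. *)
have arith (b c p q : R) : (c * b) ^+ 2 < q -> q <= c * p ->
    p ^+ 2 <= b ^+ 2 * q -> False.
  move=> cb_lt q_le p_le.
  have q0 : 0 < q by exact: le_lt_trans (sqr_ge0 _) cb_lt.
  have : q * q <= (c * b) ^+ 2 * q.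
    apply: (@le_trans _ _ ((c * p) ^+ 2)).
      by rewrite -expr2 ler_sqr ?nnegrE// ?(le_trans (ltW q0))// ltW.
    by rewrite !exprMn -[leRHS]mulrA ler_wpM2l// sqr_ge0.
  by rewrite ler_pM2r// leNgt cb_lt.
have [disj|//] := @disjoint_families_or_finite_dimensional d T R.
have [n n_gt] : exists n, (C * B) ^+ 2 < n%:R.
  by exists (Num.truncn ((C * B) ^+ 2)).+1; exact: Num.Theory.truncnS_gt.
have [I [A [In mA tA /choice[x Ax]]]] := disj n.
have [e [e1 eP]] := exists_signs (fun i => @rkhs_section _ _ _ H (x i)).
pose mu : V := \sum_i e i *: sm_dirac R (x i).
(* Among the chosen points, only [x i] lies in [A i], by disjointness. *)
have mu_val i : sm_val mu (A i) = e i.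
  rewrite sm_val_sum (bigD1 i)//= sm_valZ sm_val_dirac// mem_set// mulr1.
  rewrite big1 ?addr0// => j ji.
  rewrite sm_valZ sm_val_dirac// memNset ?mulr0//.
  move=> Aij; move: ji; rewrite (tA j i)// ?eqxx//.
  by exists (x j).
have n_le : n%:R <= sm_tv mu.
  have := sum_charge_le_tv mu mA tA; apply: le_trans.
  rewrite (eq_bigr (fun=> 1)) => [|i _]; last by rewrite -/(sm_val mu _) mu_val.
  by rewrite sumr_const In.
have Phi_mu : `|Phi mu| ^+ 2 <= B ^+ 2 * n%:R.
  rewrite /mu Phi_sum; under eq_bigr do rewrite PhiZ kernel_embedding_dirac//.
  apply: le_trans eP _; rewrite -In mulr_natr -sumr_const.
  by apply: ler_sum => i _; rewrite ler_sqr ?nnegrE// ltW.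
have [] := arith B C `|Phi mu| n%:R n_gt (le_trans n_le (tv_le mu)) Phi_mu.
Qed.

End equivalences.

Theorem theorem3p1 (R : realType) (d : measure_display) (T : measurableType d)
    (k : T -> T -> R) (H : rkhs k) :
  is_kernel k ->
  measurable_fun [set: T * T] (fun p : T * T => k p.1 p.2) ->
  [bounded k p.1 p.2 | p in [set: T * T]] ->
  injective (kernel_embedding H) ->
  [<-> finite_dimensional (signed_measure T R);
       equivalent_norms (rkhs_norm H) (fun mu : signed_measure T R => tv_norm mu);
       complete_norm (rkhs_norm H);
       forall h : H, exists mu : signed_measure T R, kernel_embedding H mu = h].
Proof.
move=> _ mk bk Phi_inj; do !split.
- exact: finite_dimensional_equivalent_norms.
- exact: equivalent_norms_complete.
- exact: complete_surjective.
- exact: surjective_finite_dimensional.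
Qed.
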